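(* Over the alphabet $\{a,b\}$, let $L_2$ be the language of all words that start with an even number of letters $a$ and in which, after the first letter $b$ (if there is one), there is an odd number of letters $a$; let $L_3$ be the language of all words that start with an odd number of letters $a$ and in which, after the first letter $b$ (if there is one), there is an odd number of letters $a$. Then $L_2$ and $L_3$ are each recognizable by a QFA, but their union $L_1=L_2\cup L_3$ is not recognizable by a QFA.
   Context: ''Starts with an even (odd) number of letters $a$'' refers to the number of $a$'s preceding the first $b$ (the total number of $a$'s if the word contains no $b$). ''After the first $b$ there is an odd number of $a$'s'' refers to the total number of $a$'s occurring after the first $b$; this condition is void for words without $b$. A 1-way quantum finite automaton (QFA) is a tuple $(Q,\Sigma,V,q_0,Q_{acc},Q_{rej})$: $Q$ is a finite set of states, $\Sigma$ a finite input alphabet, $q_0\in Q$ the starting state, $Q_{acc},Q_{rej}\subseteq Q$ are disjoint sets of accepting and rejecting states, and $Q_{non}=Q\setminus(Q_{acc}\cup Q_{rej})$. Let $l_2(Q)$ be the complex Hilbert space with orthonormal basis $\{|q\rangle: q\in Q\}$, and $E_{acc},E_{rej},E_{non}$ the spans of $\{|q\rangle\}$ for $q$ in $Q_{acc},Q_{rej},Q_{non}$ respectively. With endmarkers $\kappa,\$\notin\Sigma$ and $\Gamma=\Sigma\cup\{\kappa,\$\}$, $V$ assigns to each letter of $\Gamma$ a unitary map on $l_2(Q)$ (written $V_c$ for $c\in\Gamma$). On input $w\in\Sigma^*$ the automaton starts in $|q_0\rangle$ and reads the letters of $\kappa w\$$ in order. Reading $c$ in the current (unnormalized) superposition $\psi$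 means: compute $V_c\psi$; the automaton accepts (and halts) with probability the squared norm of the projection of $V_c\psi$ onto $E_{acc}$, rejects (and halts) with probability the squared norm of its projection onto $E_{rej}$, and otherwise continues with the unnormalized superposition equal to the projection of $V_c\psi$ onto $E_{non}$. The probability of accepting (rejecting) $w$ is the sum of these acceptance (rejection) probabilities over all letters of $\kappa w\$$. A QFA recognizes $L$ with probability $p>\frac12$ if it accepts every $w\in L$ with probability $\geq p$ and rejects every $w\in\Sigma^*\setminus L$ with probability $\geq p$. $L$ is recognizable by a QFA if this holds for some QFA and some $p>\frac12$. *)

(* Defs.v *)
From HB Require Import structures.
From mathcomp Require Import all_boot all_order all_algebra.
From mathcomp Require Import spectral.
From mathcomp Require Import complex.
From mathcomp Require Import reals.

Set Implicit Arguments.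
Unset Strict Implicit.
Unset Printing Implicit Defensive.

Import Order.TTheory GRing.Theory Num.Theory.
Local Open Scope ring_scope.

Inductive tape_symbol (Sigma : Type) : Type :=
  | LeftEnd
  | RightEnd
  | Letter of Sigma.

Arguments LeftEnd {Sigma}.
Arguments RightEnd {Sigma}.
Arguments Letter {Sigma} _.

Definition tape (Sigma : Type) (w : seq Sigma) : seq (tape_symbol Sigma) :=
  LeftEnd :: rcons (map Letter w) RightEnd.

(* l_2(Q) is represented by column vectors indexed through [enum_rank]:
   the coordinate of |q> is the entry of index [enum_rank q]. *)
Definition state_vector (R : realType) (Q : finType) := 'cV[R[i]]_#|Q|.

Definition ket (R : realType) (Q : finType) (q : Q) : state_vector R Q :=
  \col_i (enum_val i == q)%:R.

Definition proj_span (R : realType) (Q : finType) (A : {set Q})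
    (psi : state_vector R Q) : state_vector R Q :=
  \col_i (if enum_val i \in A then psi i 0 else 0).

Definition sqnorm (R : realType) (Q : finType) (psi : state_vector R Q) : R :=
  \sum_i Normc.normc (psi i 0) ^+ 2.

Record qfa (R : realType) (Sigma : finType) := QFA {
  state : finType;
  trans : tape_symbol Sigma -> 'M[R[i]]_#|state|;
  start : state;
  acc : {set state};
  rej : {set state};
  trans_unitary : forall c, trans c \is unitarymx;
  acc_rej_disjoint : [disjoint acc & rej] }.

Section Run.
Variables (R : realType) (Sigma : finType) (M : qfa R Sigma).

Definition nonhalting : {set state M} := ~: (acc M :|: rej M).

(* Probability of halting in [H] (meant to be [acc M] or [rej M]) while reading
   the tape contents [s] from the unnormalized superposition [psi]. *)
Fixpoint halt_prob (H : {set state M}) (psi : state_vector R (state M))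
    (s : seq (tape_symbol Sigma)) : R :=
  if s is c :: s' then
    let phi := trans M c *m psi in
    sqnorm (proj_span H phi) + halt_prob H (proj_span nonhalting phi) s'
  else 0.

Definition accept_prob (w : seq Sigma) : R :=
  halt_prob (acc M) (ket R (start M)) (tape w).

Definition reject_prob (w : seq Sigma) : R :=
  halt_prob (rej M) (ket R (start M)) (tape w).

Definition recognizes_with (L : pred (seq Sigma)) (p : R) : Prop :=
  forall w : seq Sigma,
    (w \in L -> p <= accept_prob w) /\ (w \notin L -> p <= reject_prob w).

End Run.

Definition recognizable (R : realType) (Sigma : finType)
    (L : pred (seq Sigma)) : Prop :=
  exists (M : qfa R Sigma) (p : R), 1 / 2 < p /\ recognizes_with M L p.

Inductive ab : Set := letter_a | letter_b.

Definition bool_of_ab (x : ab) : bool := if x is letter_a then true else false.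
Definition ab_of_bool (c : bool) : ab := if c then letter_a else letter_b.

Lemma bool_of_abK : cancel bool_of_ab ab_of_bool.
Proof. by case. Qed.

HB.instance Definition _ := Finite.copy ab (can_type bool_of_abK).

(* [index letter_b w] is [size w] when [w] contains no letter b. *)
Definition num_a_before_b (w : seq ab) : nat :=
  count_mem letter_a (take (index letter_b w) w).

Definition num_a_after_b (w : seq ab) : nat :=
  count_mem letter_a (drop (index letter_b w).+1 w).

Definition L2 : pred (seq ab) := fun w =>
  ~~ odd (num_a_before_b w) && ((letter_b \in w) ==> odd (num_a_after_b w)).

Definition L3 : pred (seq ab) := fun w =>
  odd (num_a_before_b w) && ((letter_b \in w) ==> odd (num_a_after_b w)).

Definition L1 : pred (seq ab) := [predU L2 & L3].

(* Main.v *)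
Require Import Defs.
From mathcomp Require Import all_boot all_order all_algebra.
From mathcomp Require Import ring lra complex spectral.
From mathcomp Require Import boolp classical_sets reals topology normedtype.

(* Recognizability of L2 and L3: with amplitude 4/5 a parity counter is started
   that is only consulted at the first b (it then rejects if the parity is
   wrong, and otherwise halts at random) or at the right end; with amplitude 3/5
   a second counter records the parity of all the a's.  When the first parity is
   right, the total parity determines the parity after the first b.

   Non-recognizability of L1: let x = b and y = aba.  Reading a word without
   halting is a contraction, and so is its adjoint.  In the closure of a
   semigroup S of such contractions, consider elements of least Frobenius norm.
   An idempotent one is self-adjoint, and for two such idempotents E and F,
   minimality makes F isometric on the range of E, so E = F F E = F E, and
   symmetrically F = E F; taking adjoints, E = F.  Since the closures of S X and
   of S Y both contain such an idempotent, there are U, W in S with U X close to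
   W Y.  Hence there are u, v with evenly many a's such that x u and y v leave
   the automaton in nearly the same nonhalting superposition, although y v
   and x u a are in L1, while x u and y v a are not.  Summing the four
   inequalities on acceptance probabilities yields p <= 1/2. *)

Set Implicit Arguments.
Unset Strict Implicit.
Unset Printing Implicit Defensive.

Import Order.TTheory GRing.Theory Num.Theory.
Import numFieldNormedType.Exports.
Local Open Scope ring_scope.
Local Open Scope sesquilinear_scope.

(** * Semigroups of contractions *)

Section Frobenius.
Variable R : realType.

(** Kept squared to avoid square roots; the weighted bound [frob2D_le] stands in for the triangle
    inequality. *)
Definition frob2 m n (A : 'M[R]_(m, n)) : R := \sum_i \sum_j A i j ^+ 2.

Lemma frob2_ge0 m n (A : 'M[R]_(m, n)) : 0 <= frob2 A.
Proof. by apply: sumr_ge0 => i _; apply: sumr_ge0 => j _; exact: sqr_ge0. Qed.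

Lemma frob2_entry m n (A : 'M[R]_(m, n)) i j : A i j ^+ 2 <= frob2 A.
Proof.
rewrite /frob2 (bigD1 i) //= (bigD1 j) //= -addrA lerDl addr_ge0 //.
  by apply: sumr_ge0 => ? _; exact: sqr_ge0.
by apply: sumr_ge0 => ? _; apply: sumr_ge0 => ? _; exact: sqr_ge0.
Qed.

Lemma frob2_eq0 m n (A : 'M[R]_(m, n)) : frob2 A <= 0 -> A = 0.
Proof.
move=> A0; apply/matrixP => i j; rewrite mxE; apply/eqP.
by rewrite -sqrf_eq0 eq_le sqr_ge0 (le_trans (frob2_entry A i j)).
Qed.

Lemma frob2E m n (A : 'M[R]_(m, n)) : frob2 A = \tr (A^T *m A).
Proof.
rewrite /frob2 exchange_big; apply: eq_bigr => j _; rewrite mxE.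
by apply: eq_bigr => i _; rewrite mxE expr2.
Qed.

Lemma frob2T m n (A : 'M[R]_(m, n)) : frob2 A^T = frob2 A.
Proof. by rewrite !frob2E trmxK mxtrace_mulC. Qed.

Lemma frob2N m n (A : 'M[R]_(m, n)) : frob2 (- A) = frob2 A.
Proof. by apply: eq_bigr => i _; apply: eq_bigr => j _; rewrite mxE sqrrN. Qed.

Lemma frob2B m n (A B : 'M[R]_(m, n)) : frob2 (A - B) = frob2 (B - A).
Proof. by rewrite -frob2N opprB. Qed.

(* AM-GM: [2 a b <= d a^2 + b^2 / d] *)
Lemma sqrD_le (d a b : R) :
  0 < d -> (a + b) ^+ 2 <= (1 + d) * a ^+ 2 + (1 + d^-1) * b ^+ 2.
Proof.
move=> d0; rewrite -subr_ge0.
suff -> : (1 + d) * a ^+ 2 + (1 + d^-1) * b ^+ 2 - (a + b) ^+ 2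
  = d^-1 * (d * a - b) ^+ 2 by rewrite mulr_ge0 ?sqr_ge0// invr_ge0 ltW.
by field; rewrite gt_eqF.
Qed.

Lemma frob2D_le m n (A B : 'M[R]_(m, n)) d :
  0 < d -> frob2 (A + B) <= (1 + d) * frob2 A + (1 + d^-1) * frob2 B.
Proof.
move=> d0; rewrite /frob2 !mulr_sumr -big_split /=; apply: ler_sum => i _.
by rewrite !mulr_sumr -big_split /=; apply: ler_sum => j _; rewrite mxE sqrD_le.
Qed.

Lemma frob2D_le2 m n (A B : 'M[R]_(m, n)) :
  frob2 (A + B) <= 2 * frob2 A + 2 * frob2 B.
Proof. by apply: le_trans (frob2D_le A B ltr01) _; rewrite invr1. Qed.

(** Cauchy-Schwarz, by expanding a sum of squares; when [b] vanishes that sum says nothing, but both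
    sides are 0. *)
Lemma sum_sqrM_le n (a b : 'I_n -> R) :
  (\sum_i a i * b i) ^+ 2 <= (\sum_i a i ^+ 2) * (\sum_i b i ^+ 2).
Proof.
set s := \sum_i a i * b i; set x := \sum_i a i ^+ 2; set y := \sum_i b i ^+ 2.
have y0 : 0 <= y by apply: sumr_ge0 => i _; exact: sqr_ge0.
have : 0 <= \sum_i (y * a i - s * b i) ^+ 2.
  by apply: sumr_ge0 => i _; exact: sqr_ge0.
have -> : \sum_i (y * a i - s * b i) ^+ 2 = y * (x * y - s ^+ 2).
  transitivity (y ^+ 2 * x - (2 * y * s) * s + s ^+ 2 * y); last by ring.
  rewrite [in LHS](eq_bigr (fun i => y ^+ 2 * a i ^+ 2
    - (2 * y * s) * (a i * b i) + s ^+ 2 * b i ^+ 2)); last by move=> i _; ring.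
  by rewrite big_split sumrB -!mulr_sumr.
move: y0; rewrite le_eqVlt => /predU1P[y0 _|y0]; last first.
  by rewrite pmulr_rge0 // subr_ge0.
have b0 i : b i = 0.
  apply/eqP; rewrite -sqrf_eq0 eq_le sqr_ge0 y0 andbT.
  by rewrite /y (bigD1 i) //= lerDl sumr_ge0 // => ? _; exact: sqr_ge0.
by rewrite -y0 mulr0 /s big1 ?expr0n // => i _; rewrite b0 mulr0.
Qed.

Lemma frob2M_le m n p (A : 'M[R]_(m, n)) (B : 'M[R]_(n, p)) :
  frob2 (A *m B) <= frob2 A * frob2 B.
Proof.
rewrite -(frob2T B) /frob2 mulr_suml; apply: ler_sum => i _.
rewrite mulr_sumr; apply: ler_sum => j _; rewrite mxE.
apply: le_trans (sum_sqrM_le _ _) _.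
apply: ler_wpM2l; first by apply: sumr_ge0 => k _; exact: sqr_ge0.
by apply: ler_sum => k _; rewrite mxE.
Qed.

(** Quantifying over [X] of every width lets the bound apply directly to matrix products. *)
Definition contraction m n (A : 'M[R]_(m, n)) :=
  forall p (X : 'M[R]_(n, p)), frob2 (A *m X) <= frob2 X.

Lemma contraction1 n : contraction (1%:M : 'M[R]_n).
Proof. by move=> p X; rewrite mul1mx. Qed.

Lemma contractionM m n p (A : 'M[R]_(m, n)) (B : 'M[R]_(n, p)) :
  contraction A -> contraction B -> contraction (A *m B).
Proof. by move=> cA cB q X; rewrite -mulmxA (le_trans (cA _ _)). Qed.

Lemma contraction_isometry m n (A : 'M[R]_(m, n)) :
  A^T *m A = 1%:M -> contraction A.
Proof.
by move=> A1 p X; rewrite !frob2E trmx_mul mulmxA -[_ *m A]mulmxA A1 mulmx1.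
Qed.

Lemma frob2B_expand m n (A B : 'M[R]_(m, n)) :
  frob2 (A - B) = frob2 A - 2 * \tr (A^T *m B) + frob2 B.
Proof.
have -> : frob2 (A - B) = \tr ((A^T - B^T) *m (A - B)).
  by rewrite frob2E; congr (\tr (_ *m _)); apply/matrixP => i j; rewrite !mxE.
rewrite !frob2E mulmxBl !mulmxBr !linearB /=.
have -> : \tr (B^T *m A) = \tr (A^T *m B).
  by rewrite -mxtrace_tr trmx_mul trmxK.
ring.
Qed.

Lemma contraction_projection n (P : 'M[R]_n) :
  P^T = P -> P *m P = P -> contraction P.
Proof.
move=> PT PP p X; have := frob2_ge0 (P *m X - X).
by rewrite frob2B_expand frob2E trmx_mul PT mulmxA -(mulmxA _ P P) PP; lra.
Qed.

(** Expanding, [frob2 (A^T *m (A *m B) - B)] is at most [frob2 B - frob2 (A *m B)], hence zero. *)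
Lemma frob2_isometric n p (A : 'M[R]_n) (B : 'M[R]_(n, p)) :
  contraction A^T -> frob2 B <= frob2 (A *m B) -> A^T *m (A *m B) = B.
Proof.
move=> cA le_B; apply/eqP; rewrite -subr_eq0; apply/eqP/frob2_eq0.
rewrite frob2B_expand trmx_mul trmxK -mulmxA -frob2E.
by have := cA _ (A *m B); lra.
Qed.

(** [K] may depend on [d] but not on [g], so [g] tends to 0 first and [d] afterwards. This removes
    the weights introduced by [frob2D_le] and [halt_probD_le]. *)
Lemma le_of_small_error (a c : R) :
  (forall d, 0 < d -> exists K, forall g, 0 < g -> c <= (1 + d) * a + K * g) ->
  c <= a.
Proof.
move=> H; apply/ler_addgt0Pr => e e0.
have a0 : 0 < `|a| + 1 by rewrite ltr_wpDl.
have [|K HK] := H (e / (2 * (`|a| + 1))); first by rewrite divr_gt0 // mulr_gt0.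
have K0 : 0 < `|K| + 1 by rewrite ltr_wpDl.
apply: le_trans (HK (e / (2 * (`|K| + 1))) _) _.
  by rewrite divr_gt0 // mulr_gt0.
have half x : e / (2 * (`|x| + 1)) * x <= e / 2.
  have x0 : 0 < `|x| + 1 by rewrite ltr_wpDl.
  rewrite invfM mulrA -[leRHS]mulr1 -[leLHS]mulrA ler_wpM2l //; first by lra.
  by rewrite mulrC ler_pdivrMr // mul1r (le_trans (ler_norm x)) // lerDl.
have := half a; have := half K; rewrite mulrDl mul1r [K * _]mulrC; lra.
Qed.

Lemma frob2_le_limit m n (E : 'M[R]_(m, n)) c :
  (forall e, 0 < e -> exists X, frob2 X <= c + e /\ frob2 (X - E) < e) ->
  frob2 E <= c.
Proof.
move=> limE; apply: le_of_small_error => d d0.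
exists (1 + d + (1 + d^-1)) => g g0; have [X [Xc XE]] := limE g g0.
have := frob2D_le X (E - X) d0; rewrite addrC subrK frob2B => /le_trans; apply.
rewrite [X in _ <= _ + X]mulrDl addrA -mulrDr lerD // ler_wpM2l //.
- by lra.
- by rewrite addr_ge0 // invr_ge0 ltW.
- exact: ltW.
Qed.

Lemma frob2_ge_limit m n (E : 'M[R]_(m, n)) c :
  (forall e, 0 < e -> exists X, c <= frob2 X /\ frob2 (X - E) < e) ->
  c <= frob2 E.
Proof.
move=> limE; apply: le_of_small_error => d d0.
exists (1 + d^-1) => g g0; have [X [cX XE]] := limE g g0.
rewrite (le_trans cX) // -[X in frob2 X](subrK E) addrC.
apply: le_trans (frob2D_le _ _ d0) _.
by rewrite lerD2l ler_wpM2l ?(ltW XE) // addr_ge0 // invr_ge0 ltW.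
Qed.

(** Bolzano-Weierstrass: flattened by [mxvec], the sequence stays in a compact box. *)
Lemma frob2_cluster m n (u : nat -> 'M[R]_(m, n)) c :
  (forall k, frob2 (u k) <= c) ->
  exists B, forall e, 0 < e -> forall N,
    exists k, (N <= k)%N /\ frob2 (u k - B) < e.
Proof.
move=> uc; pose v k := mxvec (u k).
have vE k a i j : v k a (mxvec_index i j) = u k i j by rewrite ord1 mxvecE.
have cK : compact [set x : 'rV[R]_(m * n) |
    forall j, `[- (c + 1), c + 1]%classic (x 0 j)].
  exact: rV_compact (fun=> @segment_compact R (- (c + 1)) (c + 1)).
have [|/= B [_ Bcl]] := cK (v @ \oo)%classic _.
  exists 0%N => // k _ /= j; rewrite in_itv /= -ler_norml.
  have c0 : 0 <= c := le_trans (frob2_ge0 _) (uc k).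
  case/mxvec_indexP: j => i j.
  rewrite vE -(@ler_pXn2r _ 2) ?nnegrE ?addr_ge0 //.
  rewrite real_normK ?num_real // (le_trans (frob2_entry _ _ _)) //.
  by rewrite (le_trans (uc k)) //; nra.
exists (vec_mx B) => e e0 N.
(* Since [d <= 1], each squared entry of the difference is at most [d]; the extra 1 in [b] makes
   their sum strictly smaller than [e]. *)
pose b : R := (m * n)%:R + 1.
have b0 : 0 < b by rewrite ltr_wpDl.
pose d := Num.min 1 (e / b).
have d0 : 0 < d by rewrite lt_min ltr01 divr_gt0.
have d1 : d <= 1 by rewrite ge_min lexx.
have db : d * b <= e by rewrite -ler_pdivlMr // ge_min lexx orbT.
have [|y [[k Nk <-] Bk]] := Bcl [set v k | k in [set k | (N <= k)%N]]%classic
  (ball B d) _ (nbhsx_ballx _ _ d0).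
  by exists N => // k /= Nk; exists k.
exists k; split=> //.
apply: (@le_lt_trans _ _ (d * (m * n)%:R)); last first.
  by rewrite (lt_le_trans _ db) // ltr_pM2l // ltrDl.
apply: (@le_trans _ _ (\sum_(i < m) \sum_(j < n) d)).
  apply: ler_sum => i _; apply: ler_sum => j _.
  have := Bk.2 0 (mxvec_index i j) => /=.
  rewrite vE -ball_normE /= => /ltW Bd.
  rewrite !mxE -real_normK ?num_real // distrC.
  by rewrite (le_trans _ Bd) // expr2 ler_piMl // (le_trans Bd).
by rewrite !sumr_const !card_ord -mulrnA mulr_natr mulnC.
Qed.

(** * Frobenius closures of sets of matrices *)

Definition limit_of n (P : 'M[R]_n -> Prop) (C : 'M[R]_n) :=
  forall e, 0 < e -> exists X, P X /\ frob2 (X - C) < e.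

Lemma limit_of_self n (P : 'M[R]_n -> Prop) C : P C -> limit_of P C.
Proof.
move=> PC e e0; exists C; split=> //; rewrite subrr /frob2 big1 // => i _.
by rewrite big1 // => j _; rewrite mxE expr0n.
Qed.

Lemma limit_of_idem n (P : 'M[R]_n -> Prop) C :
  limit_of (limit_of P) C -> limit_of P C.
Proof.
move=> PC e e0; have [|X [PX XC]] := PC (e / 4); first by lra.
have [|Y [PY YX]] := PX (e / 4); first by lra.
exists Y; split=> //; have := frob2D_le2 (Y - X) (X - C).
by rewrite addrA subrK; lra.
Qed.

(** The bound on the transpose controls multiplication on the right and feeds [frob2_isometric]. *)
Definition bicontraction n (A : 'M[R]_n) := contraction A /\ contraction A^T.

Lemma bicontraction1 n : bicontraction (1%:M : 'M[R]_n).
Proof. by split; rewrite ?trmx1; exact: contraction1. Qed.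

Lemma bicontractionM n (A B : 'M[R]_n) :
  bicontraction A -> bicontraction B -> bicontraction (A *m B).
Proof.
by move=> [A1 A2] [B1 B2]; split; rewrite ?trmx_mul; exact: contractionM.
Qed.

Lemma frob2_mulr_le m n (A : 'M[R]_(m, n)) (B : 'M[R]_n) :
  bicontraction B -> frob2 (A *m B) <= frob2 A.
Proof. by move=> [_ B2]; rewrite -frob2T trmx_mul -[leRHS]frob2T. Qed.

Lemma contraction_limit n (P : 'M[R]_n -> Prop) C :
  (forall X, P X -> contraction X) -> limit_of P C -> contraction C.
Proof.
move=> cP PC p Y; apply: frob2_le_limit => e e0.
have Y0 : 0 < frob2 Y + 1 by have := frob2_ge0 Y; lra.
have [|X [PX XC]] := PC (e / (frob2 Y + 1)); first by rewrite divr_gt0.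
exists (X *m Y); split; first by have := cP X PX _ Y; lra.
rewrite -mulmxBl (le_lt_trans (frob2M_le _ _)) //.
apply: (@le_lt_trans _ _ (frob2 (X - C) * (frob2 Y + 1))).
  by rewrite ler_wpM2l ?frob2_ge0 //; lra.
by rewrite -ltr_pdivlMr.
Qed.

Lemma bicontraction_limit n (P : 'M[R]_n -> Prop) C :
  (forall X, P X -> bicontraction X) -> limit_of P C -> bicontraction C.
Proof.
move=> cP PC; split; first by apply: contraction_limit PC => X /cP[].
apply: (@contraction_limit _ (fun X => P X^T)) => [X /cP[]|e e0].
  by rewrite trmxK.
have [X [PX XC]] := PC e e0; exists X^T; rewrite trmxK; split=> //.
by rewrite -linearB frob2T.
Qed.

(** The error splits into [(X - C) *m D] and [X *m (Y - D)]; neither [X] nor [D], a limit of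
    bicontractions, enlarges its part. *)
Lemma limit_ofM n (P Q S : 'M[R]_n -> Prop) C D :
  (forall X, P X -> bicontraction X) -> (forall X, Q X -> bicontraction X) ->
  (forall X Y, P X -> Q Y -> S (X *m Y)) ->
  limit_of P C -> limit_of Q D -> limit_of S (C *m D).
Proof.
move=> cP cQ SPQ PC QD e e0; have e4 : 0 < e / 4 by lra.
have [X [PX XC]] := PC _ e4; have [Y [QY YD]] := QD _ e4.
exists (X *m Y); split; first exact: SPQ.
have -> : X *m Y - C *m D = (X - C) *m D + X *m (Y - D).
  by rewrite mulmxBl mulmxBr [RHS]addrC addrA subrK.
have := frob2D_le2 ((X - C) *m D) (X *m (Y - D)).
have := frob2_mulr_le (X - C) (bicontraction_limit cQ QD).
by have := (cP X PX).1 _ (Y - D); lra.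
Qed.

End Frobenius.

(** * Minimal elements and idempotents of the closure *)

Section MinimalIdempotent.
Variables (R : realType) (n : nat) (S : 'M[R]_n -> Prop).
Hypotheses (S1 : S 1%:M) (SM : forall X Y, S X -> S Y -> S (X *m Y)).
Hypothesis (cS : forall X, S X -> bicontraction X).

Definition minimal (B : 'M[R]_n) :=
  limit_of S B /\ forall C, limit_of S C -> frob2 B <= frob2 C.

Lemma closureM X Y : limit_of S X -> limit_of S Y -> limit_of S (X *m Y).
Proof. exact: limit_ofM. Qed.

Lemma closure_bicontraction X : limit_of S X -> bicontraction X.
Proof. exact: bicontraction_limit. Qed.

Lemma closure_frob2_le X : limit_of S X -> frob2 X <= frob2 (1%:M : 'M[R]_n).
Proof.
by move=> /closure_bicontraction[cX _]; rewrite -[X in frob2 X]mulmx1.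
Qed.

(** A cluster point of a minimizing sequence in [S]; the infimum over [S] also bounds the closure
    from below. *)
Lemma minimal_exists : exists B, minimal B.
Proof.
pose N : set R := [set frob2 X | X in S]%classic.
have hN : has_inf N.
  split; first by exists (frob2 (1%:M : 'M[R]_n)), 1%:M.
  by exists 0 => _ [X _ <-]; exact: frob2_ge0.
have /choice[u uP] (k : nat) : exists X, S X /\ frob2 X < inf N + k.+1%:R^-1.
  have [|_ [X SX <-] XN] := @inf_adherent _ N k.+1%:R^-1 _ hN.
    by rewrite invr_gt0.
  by exists X.
have [|B Bu] := @frob2_cluster R n n u (frob2 (1%:M : 'M[R]_n)).
  by move=> k; apply/closure_frob2_le/limit_of_self; exact: (uP k).1.
exists B; split=> [e e0|C SC].
  have [k [_ uB]] := Bu e e0 0; exists (u k); split=> //; exact: (uP k).1.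
suff B_le : frob2 B <= inf N.
  rewrite (le_trans B_le) //; apply: frob2_ge_limit => e /SC[X [SX XC]].
  exists X; split=> //; apply: ge_inf; [exact: hN.2|by exists X].
(* From index [Num.truncn e^-1] on, [k.+1%:R^-1 < e]. *)
apply: frob2_le_limit => e e0; have [k [ke uB]] := Bu e e0 (Num.truncn e^-1).
exists (u k); split=> //; apply/ltW/(lt_trans (uP k).2).
rewrite ltrD2l invf_plt ?posrE // (lt_le_trans (truncnS_gt _)) //.
by rewrite ler_nat ltnS.
Qed.

Lemma minimal_le B C :
  minimal B -> limit_of S C -> frob2 C <= frob2 B -> minimal C.
Proof. by move=> [_ Bmin] SC CB; split=> // D /Bmin; exact: le_trans. Qed.

(** [C *m B] lies in the closure again, so by minimality [C] does not shrink [B]. *)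
Lemma minimal_isometric B C : minimal B -> limit_of S C -> C^T *m (C *m B) = B.
Proof.
move=> [SB Bmin] SC; apply: frob2_isometric (closure_bicontraction SC).2 _.
exact/Bmin/closureM.
Qed.

Lemma minimal_pow B k : minimal B -> minimal (B ^+ k.+1).
Proof.
move=> Bmin; elim: k => // k IH; rewrite exprS.
apply: (minimal_le IH); first exact: closureM Bmin.1 IH.1.
exact: (closure_bicontraction Bmin.1).1.
Qed.

(** Two powers of [B] near a common cluster point are near each other. Multiplying both on the left
    by a power of [B^T] reduces them to [B] and a higher power without enlarging the distance. *)
Lemma minimal_recurrent B e : minimal B -> 0 < e ->
  exists k, frob2 (B ^+ k.+2 - B) < e.
Proof.
move=> Bmin e0; have e4 : 0 < e / 4 by lra.
have [|C CB] :=
  @frob2_cluster R n n (fun k => B ^+ k.+1) (frob2 (1%:M : 'M[R]_n)).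
  by move=> k; apply: closure_frob2_le; case: (minimal_pow k Bmin).
have [i [_ iC]] := CB _ e4 0; have [j [ij jC]] := CB _ e4 i.+1.
exists (j - i.+1)%N.
have BB k : (B^T) ^+ i *m B ^+ (i + k.+1) = B ^+ k.+1.
  elim: i {iC ij} k => [|i IH] k; first by rewrite mul1mx.
  rewrite exprSr -mulmxA addSn exprS addnS.
  by rewrite (minimal_isometric (minimal_pow (i + k) Bmin) Bmin.1) -addnS IH.
have -> : B ^+ (j - i.+1).+2 - B = (B^T) ^+ i *m (B ^+ j.+1 - B ^+ i.+1).
  have := BB (j - i.+1).+1; have := BB 0; rewrite mulmxBr addn1 => ->.
  by rewrite 2!addnS -addSn subnKC // => ->.
have cBi : contraction ((B^T) ^+ i).
  elim: i {BB iC ij} => [|i IH]; first exact: contraction1.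
  rewrite exprS; apply: contractionM => //.
  exact: (closure_bicontraction Bmin.1).2.
apply: le_lt_trans (cBi _ _) _.
have := frob2D_le2 (B ^+ j.+1 - C) (C - B ^+ i.+1).
by rewrite addrA subrK [frob2 (C - _)]frob2B; lra.
Qed.

(** [B = B0 *m X] is minimal and lies in the closure of [S X]. [E] is a cluster point of powers
    [B ^+ j.+1] with [B ^+ j.+2] close to [B], so it is a left identity for [B], then for the powers
    of [B], then for itself. *)
Lemma minimal_idempotent X : S X ->
  exists E, [/\ minimal E, E *m E = E &
    limit_of (fun Z => exists2 Y, S Y & Z = Y *m X) E].
Proof.
move=> SX; pose P Z := exists2 Y, S Y & Z = Y *m X.
have PS Z : P Z -> S Z by move=> [Y SY ->]; exact: SM.
have [B0 B0min] := minimal_exists; pose B := B0 *m X.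
have PB : limit_of P B.
  apply: (@limit_ofM _ _ S (eq X)) => // [_ <-|Y _ SY <-||]; first exact: cS.
  - by exists Y.
  - exact: B0min.1.
  - exact: limit_of_self.
have limPS Z : limit_of P Z -> limit_of S Z.
  by move=> PZ e /PZ[Y [/PS SY YZ]]; exists Y.
have Bmin : minimal B.
  apply: minimal_le B0min (limPS _ PB) _; exact/frob2_mulr_le/cS.
have cB := closure_bicontraction Bmin.1.
(* Left multiplication by the closure of [S] preserves the closure of [S X], so it suffices that the
   last factor [B] comes from there. *)
have PBk k : limit_of P (B ^+ k.+1).
  case: k => // k; rewrite exprSr.
  apply: (limit_ofM (P := S) (Q := P)) PB => //.
  - by move=> Z /PS/cS.
  - by move=> Y _ SY [Z SZ ->]; exists (Y *m Z); [exact: SM|rewrite mulmxA].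
  - exact: (minimal_pow k Bmin).1.
have /choice[f fP] (k : nat) : exists j, frob2 (B ^+ j.+2 - B) < k.+1%:R^-1.
  by apply: minimal_recurrent; rewrite ?invr_gt0.
have [|E Ef] :=
  @frob2_cluster R n n (fun k => B ^+ (f k).+1) (frob2 (1%:M : 'M[R]_n)).
  by move=> k; apply: closure_frob2_le; case: (minimal_pow (f k) Bmin).
have PE : limit_of P E.
  apply: limit_of_idem => e e0; have [k [_ kE]] := Ef e e0 0.
  by exists (B ^+ (f k).+1).
have EB : E *m B = B.
  apply/eqP; rewrite -subr_eq0; apply/eqP/frob2_eq0/ler_addgt0Pr => e e0.
  have e4 : 0 < e / 4 by lra.
  have [k [ke kE]] := Ef _ e4 (Num.truncn (e / 4)^-1).
  have := frob2D_le2 ((E - B ^+ (f k).+1) *m B) (B ^+ (f k).+2 - B).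
  have BS : B ^+ (f k).+2 = B ^+ (f k).+1 *m B by exact: exprSr.
  rewrite BS mulmxBl addrA subrK => /le_trans; apply.
  have := frob2_mulr_le (E - B ^+ (f k).+1) cB.
  rewrite mulmxBl [frob2 (E - _)]frob2B.
  have : frob2 (B ^+ (f k).+1 *m B - B) < e / 4.
    rewrite -BS (lt_trans (fP k)) // invf_plt ?posrE //.
    by rewrite (lt_le_trans (truncnS_gt _)) // ler_nat ltnS.
  lra.
have EBk k : E *m B ^+ k.+1 = B ^+ k.+1 by rewrite exprS mulmxA EB.
have Emin : minimal E.
  apply: (minimal_le Bmin (limPS _ PE)); apply: frob2_le_limit => e e0.
  have [k [_ kE]] := Ef e e0 0; exists (B ^+ (f k).+1); split=> //.
  have := (minimal_pow (f k) Bmin).2 _ Bmin.1; lra.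
exists E; split=> //.
apply/eqP; rewrite -subr_eq0; apply/eqP/frob2_eq0/ler_addgt0Pr => e e0.
have e4 : 0 < e / 4 by lra.
have [k [_ kE]] := Ef _ e4 0.
have := frob2D_le2 (E *m (E - B ^+ (f k).+1)) (B ^+ (f k).+1 - E).
rewrite mulmxBr EBk addrA subrK => /le_trans; apply.
have := (closure_bicontraction (limPS _ PE)).1 _ (E - B ^+ (f k).+1).
by rewrite mulmxBr EBk [frob2 (E - _)]frob2B; lra.
Qed.

(** Being isometric on its own range, [E] equals [E^T *m E], which is symmetric. *)
Lemma minimal_idempotent_sym (E : 'M[R]_n) :
  minimal E -> E *m E = E -> E^T = E.
Proof.
move=> Emin EE; have := minimal_isometric Emin Emin.1; rewrite EE => ETE.
by rewrite -[RHS]ETE -[in RHS](trmxK E) -trmx_mul trmxK ETE.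
Qed.

Lemma minimal_idempotent_uniq (E F : 'M[R]_n) :
  minimal E -> E *m E = E -> minimal F -> F *m F = F -> E = F.
Proof.
move=> Emin EE Fmin FF.
have ET := minimal_idempotent_sym Emin EE.
have FT := minimal_idempotent_sym Fmin FF.
have FE : F *m E = E.
  by have := minimal_isometric Emin Fmin.1; rewrite FT mulmxA FF.
have EF : E *m F = F.
  by have := minimal_isometric Fmin Emin.1; rewrite ET mulmxA EE.
by rewrite -ET -FE trmx_mul ET FT EF.
Qed.

(** The closures of [S X] and [S Y] contain the same minimal idempotent, which both ideals therefore
    approximate. *)
Lemma left_ideals_meet (X Y : 'M[R]_n) e : S X -> S Y -> 0 < e ->
  exists U W, [/\ S U, S W & frob2 (U *m X - W *m Y) < e].
Proof.
move=> SX SY e0; have e4 : 0 < e / 4 by lra.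
have [E [Emin EE EX]] := minimal_idempotent SX.
have [F [Fmin FF FY]] := minimal_idempotent SY.
have EF := minimal_idempotent_uniq Emin EE Fmin FF; subst F.
have [_ [[U SU ->] UX]] := EX _ e4; have [_ [[W SW ->] WY]] := FY _ e4.
exists U, W; split=> //.
have := frob2D_le2 (U *m X - E) (E - W *m Y).
by rewrite addrA subrK [frob2 (E - _)]frob2B; lra.
Qed.

End MinimalIdempotent.

(** * Superpositions as real vectors *)

Section Realification.
Variable R : realType.
Local Notation C := R[i].
Local Notation re := (@complex.Re R).
Local Notation im := (@complex.Im R).

(** Complex numbers as 2 by 2 real blocks: products are preserved and adjoints become transposes, so
    the real theory of contractions covers unitaries and projections. *)
Definition realify m n (A : 'M[C]_(m, n)) : 'M[R]_(m + m, n + n) :=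
  block_mx (map_mx re A) (- map_mx im A) (map_mx im A) (map_mx re A).

Lemma realifyD m n (A B : 'M[C]_(m, n)) :
  realify (A + B) = realify A + realify B.
Proof.
rewrite /realify add_block_mx.
congr block_mx; apply/matrixP => i j; rewrite !mxE //.
all: by case: (A i j) (B i j) => [? ?] [? ?] /=; rewrite ?opprD.
Qed.

Lemma realifyB m n (A B : 'M[C]_(m, n)) :
  realify (A - B) = realify A - realify B.
Proof.
rewrite /realify opp_block_mx add_block_mx -!raddfB /=.
congr block_mx; apply/matrixP => i j; rewrite !mxE //.
all: by case: (A i j) (B i j) => [? ?] [? ?].
Qed.

Lemma map_mx_reM m n p (A : 'M[C]_(m, n)) (B : 'M[C]_(n, p)) :
  map_mx re (A *m B) = map_mx re A *m map_mx re B - map_mx im A *m map_mx im B.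
Proof.
apply/matrixP => i j; rewrite !mxE raddf_sum -sumrB; apply: eq_bigr => k _.
by rewrite !mxE; case: (A i k) (B k j) => [? ?] [? ?].
Qed.

Lemma map_mx_imM m n p (A : 'M[C]_(m, n)) (B : 'M[C]_(n, p)) :
  map_mx im (A *m B) = map_mx re A *m map_mx im B + map_mx im A *m map_mx re B.
Proof.
apply/matrixP => i j; rewrite !mxE raddf_sum -big_split; apply: eq_bigr => k _.
by rewrite !mxE; case: (A i k) (B k j) => [? ?] [? ?].
Qed.

Lemma realifyM m n p (A : 'M[C]_(m, n)) (B : 'M[C]_(n, p)) :
  realify (A *m B) = realify A *m realify B.
Proof.
rewrite /realify mulmx_block map_mx_reM map_mx_imM.
by congr block_mx; rewrite ?mulNmx ?mulmxN ?opprD // addrC.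
Qed.

Lemma realify1 n : realify (1%:M : 'M[C]_n) = 1%:M.
Proof.
rewrite /realify scalar_mx_block.
congr block_mx; apply/matrixP => i j; rewrite !mxE.
all: by case: (_ == _); rewrite ?mulr1n ?mulr0n ?oppr0.
Qed.

Lemma realify_adj m n (A : 'M[C]_(m, n)) : realify (A ^t*) = (realify A)^T.
Proof.
rewrite /realify tr_block_mx.
congr block_mx; apply/matrixP => i j; rewrite !mxE.
all: by case: (A j i) => x y; rewrite /= ?opprK.
Qed.

Lemma frob2_block m1 m2 n1 n2 (A : 'M[R]_(m1, n1)) B D (E : 'M[R]_(m2, n2)) :
  frob2 (block_mx A B D E) = frob2 A + frob2 B + frob2 D + frob2 E.
Proof.
rewrite /frob2 big_split_ord /= -addrA.
congr (_ + _); rewrite -big_split; apply: eq_bigr => i _ /=;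
  rewrite big_split_ord /=.
  by congr (_ + _); apply: eq_bigr => j _; rewrite (block_mxEul, block_mxEur).
by congr (_ + _); apply: eq_bigr => j _; rewrite (block_mxEdl, block_mxEdr).
Qed.

Lemma frob2_realify m n (A : 'M[C]_(m, n)) :
  frob2 (realify A) = 2 * \sum_i \sum_j Normc.normc (A i j) ^+ 2.
Proof.
have -> : \sum_i \sum_j Normc.normc (A i j) ^+ 2 =
    frob2 (map_mx re A) + frob2 (map_mx im A).
  rewrite /frob2 -big_split; apply: eq_bigr => i _; rewrite -big_split.
  apply: eq_bigr => j _; rewrite !mxE /=; case: (A i j) => x y /=.
  by rewrite sqr_sqrtr // addr_ge0 ?sqr_ge0.
by rewrite frob2_block frob2N; ring.
Qed.

Lemma bicontraction_realify_unitary n (V : 'M[C]_n) :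
  V \is unitarymx -> bicontraction (realify V).
Proof.
move=> Vu; have VV := unitarymxP Vu.
split; apply: contraction_isometry; rewrite ?trmxK -realify_adj -realifyM.
  by rewrite mulmx1C ?realify1.
by rewrite VV realify1.
Qed.

Lemma bicontraction_realify_projection n (P : 'M[C]_n) :
  P ^t* = P -> P *m P = P -> bicontraction (realify P).
Proof.
move=> PT PP; rewrite /bicontraction -realify_adj PT.
suff : contraction (realify P) by split.
by apply: contraction_projection; rewrite -?realify_adj -?realifyM ?PT ?PP.
Qed.

End Realification.

(** * Nonhalting evolution and halting probabilities *)

Section Halting.
Variables (R : realType) (Sigma : finType) (M : qfa R Sigma).
Local Notation n := #|state M|.
Local Notation vector := (state_vector R (state M)).

Definition proj_mx (A : {set state M}) : 'M[R[i]]_n :=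
  diag_mx (\row_i (enum_val i \in A)%:R).

Lemma proj_spanE A (psi : vector) : proj_span A psi = proj_mx A *m psi.
Proof.
apply/colP => i; rewrite mul_diag_mx !mxE.
by case: ifP; rewrite (mul1r, mul0r).
Qed.

Lemma proj_mx_adj A : (proj_mx A) ^t* = proj_mx A.
Proof.
rewrite /proj_mx tr_diag_mx map_diag_mx; congr diag_mx.
by apply/rowP => i; rewrite !mxE rmorph_nat.
Qed.

Lemma proj_mx_idem A : proj_mx A *m proj_mx A = proj_mx A.
Proof.
rewrite /proj_mx mulmx_diag; congr diag_mx; apply/rowP => i; rewrite !mxE.
by case: (_ \in _); rewrite (mulr1, mulr0).
Qed.

Lemma frob2_realify_vector (psi : vector) :
  frob2 (realify psi) = 2 * sqnorm psi.
Proof.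
rewrite frob2_realify; congr (_ * _).
by apply: eq_bigr => i _; rewrite big_ord1.
Qed.

Lemma sqnorm_ge0 (psi : vector) : 0 <= sqnorm psi.
Proof. by apply: sumr_ge0 => i _; exact: sqr_ge0. Qed.

Lemma sqnorm_ket (q : state M) : sqnorm (ket R q) = 1.
Proof.
rewrite /sqnorm (bigD1 (enum_rank q)) //= mxE enum_rankK eqxx.
rewrite big1 => [|i iq]; rewrite ?mxE.
  by rewrite Normc.normc1 expr1n addr0.
case: eqP => [iq'|_]; first by rewrite -iq' enum_valK eqxx in iq.
by rewrite Normc.normc0 expr0n.
Qed.

Lemma sqnormD_le (psi chi : vector) d : 0 < d ->
  sqnorm (psi + chi) <= (1 + d) * sqnorm psi + (1 + d^-1) * sqnorm chi.
Proof.
move=> d0; have := frob2D_le (realify psi) (realify chi) d0.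
rewrite -realifyD !frob2_realify_vector; lra.
Qed.

Lemma sqnormN (psi : vector) : sqnorm (- psi) = sqnorm psi.
Proof. by apply: eq_bigr => i _; rewrite mxE normcN. Qed.

(** After realification both [V] and its adjoint are contractions, which gives the two
    inequalities. *)
Lemma sqnorm_unitary (V : 'M[R[i]]_n) (psi : vector) :
  V \is unitarymx -> sqnorm (V *m psi : vector) = sqnorm psi.
Proof.
move=> Vu; have VV : V ^t* *m V = 1%:M by rewrite mulmx1C //; exact/unitarymxP.
have [cV cVT] := bicontraction_realify_unitary Vu.
have := cV _ (realify psi); have := cVT _ (realify (V *m psi)).
rewrite -realify_adj -!realifyM mulmxA VV mul1mx !frob2_realify_vector.
lra.
Qed.

Lemma sqnorm_split (psi : vector) :
  sqnorm (proj_span (acc M) psi) + sqnorm (proj_span (rej M) psi)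
    + sqnorm (proj_span (nonhalting M) psi) = sqnorm psi.
Proof.
rewrite /sqnorm -!big_split; apply: eq_bigr => i _; rewrite /= !mxE !inE.
have := disjointFr (@acc_rej_disjoint _ _ M) (x := enum_val i).
have n0 : Normc.normc 0 ^+ 2 = 0 :> R by rewrite Normc.normc0 expr0n.
case: (_ \in acc M); case: (_ \in rej M) => //= H; rewrite n0.
  by have := H isT.
all: ring.
Qed.

Definition step c : 'M[R[i]]_n := proj_mx (nonhalting M) *m trans M c.

(** The linear evolution of the nonhalting part; later letters act on the left, whence the order
    reversal in [run_cat]. *)
Fixpoint run (s : seq (tape_symbol Sigma)) : 'M[R[i]]_n :=
  if s is c :: s' then run s' *m step c else 1%:M.

Lemma run_cat s1 s2 : run (s1 ++ s2) = run s2 *m run s1.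
Proof. by elim: s1 => [|c s1 IH] /=; rewrite ?mulmx1 // IH mulmxA. Qed.

Lemma bicontraction_run s : bicontraction (realify (run s)).
Proof.
elim: s => [|c s IH] /=; first by rewrite realify1; exact: bicontraction1.
rewrite !realifyM; apply: bicontractionM IH _; apply: bicontractionM.
  exact: bicontraction_realify_projection (proj_mx_adj _) (proj_mx_idem _).
exact/bicontraction_realify_unitary/trans_unitary.
Qed.

Lemma halt_prob_cat H (psi : vector) s1 s2 :
  halt_prob H psi (s1 ++ s2) =
    halt_prob H psi s1 + halt_prob H (run s1 *m psi) s2.
Proof.
elim: s1 psi => [|c s1 IH] psi /=; first by rewrite mul1mx add0r.
by rewrite IH addrA /step !proj_spanE -!mulmxA.
Qed.

Lemma halt_prob_ge0 H (psi : vector) s : 0 <= halt_prob H psi s.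
Proof.
by elim: s psi => //= c s IH psi; rewrite addr_ge0 ?sqnorm_ge0.
Qed.

(** Each unitary preserves the norm, which [sqnorm_split] divides between halting and the
    superposition carried on. *)
Lemma halt_prob_total (psi : vector) s :
  halt_prob (acc M) psi s + halt_prob (rej M) psi s <= sqnorm psi.
Proof.
elim: s psi => [|c s IH] psi /=; first by rewrite addr0 sqnorm_ge0.
rewrite -(sqnorm_unitary psi (trans_unitary M c)) -[leRHS]sqnorm_split.
by have := IH (proj_span (nonhalting M) (trans M c *m psi)); lra.
Qed.

(** A halting probability is a sum of squared norms of linear images of the superposition, so it
    inherits the bound [sqnormD_le]. This makes nearby superpositions comparable. *)
Lemma halt_probD_le H (psi chi : vector) s d : 0 < d ->
  halt_prob H (psi + chi) s <=
    (1 + d) * halt_prob H psi s + (1 + d^-1) * halt_prob H chi s.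
Proof.
move=> d0; elim: s psi chi => [|c s IH] psi chi /=.
  by rewrite !mulr0 addr0.
have pD A : proj_span A (trans M c *m (psi + chi)) =
    proj_span A (trans M c *m psi) + proj_span A (trans M c *m chi).
  by rewrite !proj_spanE !mulmxDr.
rewrite !pD.
have := sqnormD_le (proj_span H (trans M c *m psi))
  (proj_span H (trans M c *m chi)) d0.
have := IH (proj_span (nonhalting M) (trans M c *m psi))
  (proj_span (nonhalting M) (trans M c *m chi)).
lra.
Qed.

Lemma accept_reject_le1 w : accept_prob M w + reject_prob M w <= 1.
Proof. by rewrite -(sqnorm_ket (start M)); exact: halt_prob_total. Qed.

End Halting.

(** * Non-recognizability of the union *)

(** The conditions of [L2] and [L3] on the initial parity are complementary, so only their common
    condition survives in the union. *)
Lemma L1P (w : seq ab) :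
  (w \in L1) = ((letter_b \in w) ==> odd (num_a_after_b w)).
Proof. by rewrite inE /= /L2 /L3 /in_mem /=; case: odd; case: (_ ==> _). Qed.

Lemma L1_after_b (u : seq ab) :
  ([:: letter_b] ++ u \in L1) = odd (count_mem letter_a u).
Proof. by rewrite L1P inE eqxx -[u in RHS]drop0. Qed.

(** The last letter of the prefix aba follows the first b and flips the parity. *)
Lemma L1_after_aba (u : seq ab) :
  ([:: letter_a; letter_b; letter_a] ++ u \in L1) =
    ~~ odd (count_mem letter_a u).
Proof.
by rewrite L1P mem_cat !inE eqxx /= /num_a_after_b /= add0n.
Qed.

Section NotRecognizable.
Variables (R : realType) (M : qfa R ab).

(** Such words are closed under concatenation, and appending one to b or aba keeps the parity of the
    a's after the first b. *)
Definition even_runs (A : 'M[R]_(#|state M| + #|state M|)) :=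
  exists2 w : seq ab,
    ~~ odd (count_mem letter_a w) & A = realify (run M (map Letter w)).

Lemma even_runs1 : even_runs 1%:M.
Proof. by exists [::]; rewrite ?realify1. Qed.

Lemma even_runsM A B : even_runs A -> even_runs B -> even_runs (A *m B).
Proof.
move=> [u u_even ->] [v v_even ->]; exists (v ++ u).
  by rewrite count_cat oddD (negbTE u_even) (negbTE v_even).
by rewrite map_cat run_cat realifyM.
Qed.

Lemma even_runs_bicontraction A : even_runs A -> bicontraction A.
Proof. by move=> [w _ ->]; exact: bicontraction_run. Qed.

Lemma accept_prob_cat (w z : seq ab) :
  accept_prob M (w ++ z) =
    halt_prob (acc M) (ket R (start M)) (LeftEnd :: map Letter w)
    + halt_prob (acc M) (run M (LeftEnd :: map Letter w) *m ket R (start M))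
        (rcons (map Letter z) RightEnd).
Proof. by rewrite -halt_prob_cat /accept_prob /tape map_cat rcons_cat. Qed.

(** [left_ideals_meet] for the runs on b and aba: left factors are the runs of appended words. *)
Lemma merging_runs e : 0 < e -> exists u v : seq ab,
  [/\ ~~ odd (count_mem letter_a u), ~~ odd (count_mem letter_a v) &
    sqnorm ((run M (LeftEnd :: map Letter ([:: letter_b] ++ u))
      - run M (LeftEnd :: map Letter ([:: letter_a; letter_b; letter_a] ++ v)))
        *m ket R (start M) : state_vector R (state M)) < e].
Proof.
move=> e0; set x := [:: letter_b]; set y := [:: letter_a; letter_b; letter_a].
have Sx : even_runs (realify (run M (map Letter x))) by exists x.
have Sy : even_runs (realify (run M (map Letter y))) by exists y.
have [_ [_ [[u u_even ->] [v v_even ->]]]] :=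
  left_ideals_meet even_runs1 even_runsM even_runs_bicontraction Sx Sy e0.
rewrite -!realifyM -!run_cat -!map_cat -realifyB => uv.
exists u, v; split=> //.
have -> : (run M (LeftEnd :: map Letter (x ++ u))
      - run M (LeftEnd :: map Letter (y ++ v))) *m ket R (start M)
    = (run M (map Letter (x ++ u)) - run M (map Letter (y ++ v)))
      *m (step M LeftEnd *m ket R (start M)) by rewrite /= -mulmxBl mulmxA.
move: (_ - _) uv => D uv.
(* What the left endmarker leaves of the start state, common to both runs. *)
set psi : state_vector R (state M) := step M LeftEnd *m ket R (start M).
have psi1 : sqnorm psi <= 1.
  have := (bicontraction_run M [:: LeftEnd]).1 _ (realify (ket R (start M))).
  rewrite /= mul1mx -realifyM (frob2_realify_vector psi).
  by rewrite (frob2_realify_vector (ket R _)) sqnorm_ket ler_pM2l.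
clearbody psi; have := frob2M_le (realify D) (realify psi).
rewrite -realifyM (frob2_realify_vector (D *m psi)) (frob2_realify_vector psi).
have : frob2 (realify D) * (2 * sqnorm psi) <= frob2 (realify D) * (2 * 1).
  by rewrite ler_wpM2l ?frob2_ge0 ?ler_pM2l.
lra.
Qed.

End NotRecognizable.

Lemma L1_not_recognizable (R : realType) : ~ recognizable R L1.
Proof.
move=> [M [p [p_half recM]]].
suff : 2 * p <= 1 by lra.
(* The bound to reach is [2 * p <= 1 + d + (1 + d^-1) * g]. *)
apply: le_of_small_error => d d0; exists (1 + d^-1) => g g0.
have [u [v [u_even v_even uv]]] := merging_runs M g0.
set w1 := [:: letter_b] ++ u in uv.
set w2 := [:: letter_a; letter_b; letter_a] ++ v in uv.
have acc_hi w : w \in L1 -> p <= accept_prob M w by case: (recM w).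
have acc_lo w : w \notin L1 -> accept_prob M w <= 1 - p.
  by case: (recM w) => _ /[apply]; have := accept_reject_le1 M w; lra.
pose phi w : state_vector R (state M) :=
  run M (LeftEnd :: map Letter w) *m ket R (start M).
have phiE : phi w1 - phi w2 = (run M (LeftEnd :: map Letter w1)
    - run M (LeftEnd :: map Letter w2)) *m ket R (start M) by rewrite mulmxBl.
pose f w z := halt_prob (acc M) (phi w) (rcons (map Letter z) RightEnd).
have f_le1 w z : f w z <= 1.
  have := accept_reject_le1 M (w ++ z); rewrite accept_prob_cat -/(f w z).
  have := halt_prob_ge0 (rej M) (ket R (start M)) (tape (w ++ z)).
  have := halt_prob_ge0 (acc M) (ket R (start M)) (LeftEnd :: map Letter w).
  rewrite /reject_prob; lra.
(* As [f w' z <= 1], the factor [1 + d] from [halt_probD_le] costs at most an additive [d]. *)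
have f_close w w' z : sqnorm (phi w - phi w') < g ->
    f w z <= f w' z + d + (1 + d^-1) * g.
  move=> ww'; rewrite /f -{1}[phi w](subrK (phi w')) addrC.
  apply: le_trans (halt_probD_le _ _ _ _ d0) _; rewrite -/(f w' z).
  apply: lerD; first by rewrite mulrDl mul1r lerD2l ler_piMr ?f_le1 // ltW.
  apply: ler_wpM2l; first by rewrite addr_ge0 // invr_ge0 ltW.
  have := halt_prob_total (phi w - phi w') (rcons (map Letter z) RightEnd).
  have := halt_prob_ge0 (rej M) (phi w - phi w')
    (rcons (map Letter z) RightEnd).
  lra.
have h1 : accept_prob M (w1 ++ [::]) <= 1 - p.
  by apply: acc_lo; rewrite -catA L1_after_b cats0.
have h2 : p <= accept_prob M (w1 ++ [:: letter_a]).
  by apply: acc_hi; rewrite -catA L1_after_b count_cat oddD (negbTE u_even).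
have h3 : p <= accept_prob M (w2 ++ [::]).
  by apply: acc_hi; rewrite -catA L1_after_aba cats0.
have h4 : accept_prob M (w2 ++ [:: letter_a]) <= 1 - p.
  by apply: acc_lo; rewrite -catA L1_after_aba count_cat oddD (negbTE v_even).
have uv' : sqnorm (phi w2 - phi w1) < g.
  by rewrite -opprB sqnormN phiE.
rewrite -phiE in uv.
have f1 := f_close _ _ [:: letter_a] uv; have f2 := f_close _ _ [::] uv'.
(* Acceptance while still reading the prefix. [q w1] and [q w2] may differ, but each occurs in one
   upper and one lower bound and cancels. *)
pose q w := halt_prob (acc M) (ket R (start M)) (LeftEnd :: map Letter w).
have accE w z : accept_prob M (w ++ z) = q w + f w z by exact: accept_prob_cat.
move: h1 h2 h3 h4 f1 f2; rewrite !accE.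
move: (q w1) (q w2) (f w1 [::]) (f w1 [:: letter_a]) (f w2 [::])
  (f w2 [:: letter_a]) (_ * g); clear=> *.
lra.
Qed.

(** * Automata for L2 and L3 *)

Section ParityAutomaton.
Variable R : realType.
Local Notation n := #|'I_8|.
Local Notation "x %:C" := (real_complex R x) : ring_scope.

(* Trailing zero coordinates may be omitted from [s]. *)
Definition vec (s : seq R) : state_vector R 'I_8 :=
  \col_i (s`_(enum_val i : 'I_8))%:C.

Definition dot (w s : seq R) : R := \sum_(k < 8) w`_k * s`_k.

(** When [c * dot w w = 2], the Householder reflection in the hyperplane orthogonal to [w]. *)
Definition reflection (c : R) (w : seq R) : 'M[R[i]]_n :=
  1%:M - c%:C *: (vec w *m (vec w)^T).

Lemma dotE (w s : seq R) :
  dot w s = \sum_(i < n) w`_(enum_val i : 'I_8) * s`_(enum_val i : 'I_8).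
Proof. exact: reindex (onW_bij _ (enum_val_bij _)). Qed.

Lemma vec_dot w s : (vec w)^T *m vec s = (dot w s)%:C%:M.
Proof.
apply/matrixP => i j; rewrite !ord1 !mxE eqxx mulr1n dotE rmorph_sum.
by apply: eq_bigr => k _; rewrite !mxE rmorphM.
Qed.

Lemma reflection_unitary c w : c * dot w w = 2 -> reflection c w \is unitarymx.
Proof.
move=> cw; apply/unitarymxP.
have conj_real (x : R) : Num.conj x%:C = x%:C by exact: conjc_real.
have -> : (reflection c w) ^t* = reflection c w.
  apply/matrixP => i j; rewrite !mxE !big_ord1 !mxE eq_sym.
  by rewrite rmorphB !rmorphM rmorph_nat /= !conj_real [X in _ - _ * X]mulrC.
set W := vec w *m (vec w)^T.
have WW : W *m W = (dot w w)%:C *: W.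
  by rewrite mulmxA -(mulmxA (vec w)) vec_dot mul_mx_scalar scalemxAl.
rewrite /reflection -/W mulmxBl mul1mx mulmxBr mulmx1 -scalemxAl -scalemxAr.
rewrite scalerA WW scalerA -!rmorphM -mulrA cw mulr_natr.
by rewrite rmorphMn -scalerMnl mulr2n opprB addrK subrK.
Qed.

Lemma reflection_vec c w s :
  reflection c w *m vec s = vec (mkseq (fun k => s`_k - c * dot w s * w`_k) 8).
Proof.
rewrite /reflection mulmxBl mul1mx -scalemxAl -mulmxA vec_dot.
rewrite mul_mx_scalar scalerA.
apply/colP => i; rewrite !mxE nth_mkseq //.
by rewrite rmorphB !rmorphM.
Qed.

Lemma proj_span_vec (A : {set 'I_8}) s :
  proj_span A (vec s) =
    vec (mkseq (fun k => if inord k \in A then s`_k else 0) 8).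
Proof.
apply/colP => i; rewrite !mxE nth_mkseq // inord_val.
by case: (_ \in A).
Qed.

Lemma sqnorm_vec s : sqnorm (vec s) = dot s s.
Proof.
rewrite /sqnorm dotE.
apply: eq_bigr => k _.
by rewrite !mxE /= expr0n addr0 sqr_sqrtr ?sqr_ge0 // expr2.
Qed.

(* 0, 1: the counter consulted at the first b; 2, 3: the total parity. *)
Definition parity_acc := [set k : 'I_8 | (4 <= k < 6)%N].
Definition parity_rej := [set k : 'I_8 | (6 <= k)%N].

Lemma parity_disjoint : [disjoint parity_acc & parity_rej].
Proof.
rewrite disjoint_subset; apply/fintype.subsetP => k; rewrite !inE => /andP[_].
by rewrite ltnNge.
Qed.

Definition swap_axis i j : seq R :=
  mkseq (fun k => (k == i)%:R - (k == j)%:R) 8.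

(** For distinct [i], [j] below 8 the axis has squared length 2, so the coefficient 1 gives a
    transposition of basis vectors. *)
Definition swap i j : 'M[R[i]]_n := reflection 1 (swap_axis i j).

Lemma dot_swap_axis i j s :
  (i < 8)%N -> (j < 8)%N -> dot (swap_axis i j) s = s`_i - s`_j.
Proof.
have pick (l : nat) : (l < 8)%N ->
    \sum_(k < 8) (nat_of_ord k == l)%:R * s`_k = s`_l.
  move=> l8; rewrite (bigD1 (Ordinal l8)) //= eqxx mul1r big1 ?addr0 // => k kl.
  by rewrite (negbTE (kl : nat_of_ord k != l)) mul0r.
move=> i8 j8; rewrite -(pick i) // -(pick j) // -sumrB.
by apply: eq_bigr => k _; rewrite nth_mkseq // mulrBl.
Qed.

Lemma swap_unitary i j :
  (i < 8)%N -> (j < 8)%N -> i != j -> swap i j \is unitarymx.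
Proof.
move=> i8 j8 ij; apply: reflection_unitary.
rewrite dot_swap_axis // !nth_mkseq // !eqxx [j == i]eq_sym (negbTE ij) /=.
by ring.
Qed.

Lemma vec_eq s s' : (forall k, (k < 8)%N -> s`_k = s'`_k) -> vec s = vec s'.
Proof. by move=> ss'; apply/colP => i; rewrite !mxE ss'. Qed.

Lemma swap_vec i j s : (i < 8)%N -> (j < 8)%N -> swap i j *m vec s =
  vec (mkseq (fun k =>
    if k == i then s`_j else if k == j then s`_i else s`_k) 8).
Proof.
move=> i8 j8; rewrite reflection_vec dot_swap_axis //; apply: vec_eq => k k8.
rewrite !nth_mkseq //.
case: (eqVneq k i) => [ki|_]; case: (eqVneq k j) => [kj|_] /=.
all: rewrite -?ki -?kj; ring.
Qed.

(* The two reflections send |t> to 4/5 |t> + 3/5 |t + 2> and |0> to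
   3/5 |4> + 4/5 |6>; each vector is scaled to avoid square roots. *)
Definition parity_trans (t : bool) (c : tape_symbol ab) : 'M[R[i]]_n :=
  match c with
  | LeftEnd => reflection 5^-1 (if t then [:: 0; 1; 0; -3] else [:: 1; 0; -3])
  | Letter letter_a => swap 0 1 *m swap 2 3
  | Letter letter_b => swap 1 7 *m reflection 25^-1 [:: 5; 0; 0; 0; -3; 0; -4]
  | RightEnd => swap 0 4 *m swap 3 5 *m (swap 2 6 *m swap 1 7)
  end.

Lemma parity_trans_unitary t c : parity_trans t c \is unitarymx.
Proof.
case: c => [||[]]; rewrite /parity_trans.
- apply: reflection_unitary; rewrite /dot !big_ord_recl big_ord0.
  by case: t => /=; field.
- by apply: mul_unitarymx; apply: mul_unitarymx; exact: swap_unitary.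
- by apply: mul_unitarymx; exact: swap_unitary.
- apply: mul_unitarymx; first exact: swap_unitary.
  by apply: reflection_unitary; rewrite /dot !big_ord_recl big_ord0 /=; field.
Qed.

Definition parity_qfa (t : bool) : qfa R ab :=
  @QFA R ab 'I_8 (parity_trans t) (inord t) parity_acc parity_rej
    (parity_trans_unitary t) parity_disjoint.

Lemma mulmx_vec (A B : 'M[R[i]]_n) s1 s2 s3 :
  A *m vec s1 = vec s2 -> B *m vec s2 = vec s3 -> B *m A *m vec s1 = vec s3.
Proof. by rewrite -mulmxA => ->. Qed.

Lemma trans_a t x y z u :
  trans (parity_qfa t) (Letter letter_a) *m vec [:: x; y; z; u] =
  vec [:: y; x; u; z].
Proof.
apply: etrans (mulmx_vec (swap_vec _ _ _) (swap_vec _ _ _)) _ => //.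
by apply: vec_eq; do 8?[case=> [//|]].
Qed.

(** The wrong-parity amplitude [y] goes to the rejecting state 7, and [x] is split between accepting
    4 and rejecting 6. The first counter is left empty, so later letters b change nothing. *)
Lemma trans_b t x y z u :
  trans (parity_qfa t) (Letter letter_b) *m vec [:: x; y; z; u] =
  vec [:: 0; 0; z; u; 3 / 5 * x; 0; 4 / 5 * x; y].
Proof.
apply: etrans (mulmx_vec (reflection_vec _ _ _) (swap_vec _ _ _)) _ => //.
apply: vec_eq.
rewrite /dot !big_ord_recl big_ord0 /=.
do 8?[case=> [_ /=|]] => //; by field.
Qed.

Lemma trans_end t x y z u :
  trans (parity_qfa t) RightEnd *m vec [:: x; y; z; u] =
  vec [:: 0; 0; 0; 0; x; u; z; y].
Proof.
by apply: etrans (mulmx_vec (mulmx_vec (swap_vec _ _ _) (swap_vec _ _ _))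
  (mulmx_vec (swap_vec _ _ _) (swap_vec _ _ _))) _.
Qed.

Lemma trans_start t :
  trans (parity_qfa t) LeftEnd *m ket R (start (parity_qfa t)) =
  vec (if t then [:: 0; 4 / 5; 0; 3 / 5] else [:: 4 / 5; 0; 3 / 5; 0]).
Proof.
have -> : ket R (start (parity_qfa t)) = vec (if t then [:: 0; 1] else [:: 1]).
  apply/colP => i; rewrite !mxE /= -val_eqE /= inordK; last by case: (t).
  by case: (t); case: (enum_val i : 'I_8) => [[|[|k]] k8]; rewrite /= ?nth_nil.
rewrite /= reflection_vec; apply: vec_eq.
rewrite /dot !big_ord_recl big_ord0 /=.
case: t; do 8?[case=> [_ /=|]] => //; by field.
Qed.

Lemma nonhaltingE t (k : 'I_8) : (k \in nonhalting (parity_qfa t)) = (k < 4)%N.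
Proof.
by rewrite !inE; case: (nat_of_ord k) => [|[|[|[|[|[|?]]]]]].
Qed.

(** The nonhalting states are the first four and [vec] pads with zeros, so the nonhalting projection
    is [take 4]. *)
Lemma halt_parity t (H : {set 'I_8}) s s' c tp :
  trans (parity_qfa t) c *m (s : state_vector R 'I_8) = vec s' ->
  halt_prob (M := parity_qfa t) H s (c :: tp) =
    dot [seq (if inord k \in H then s'`_k else 0) | k <- iota 0 8]
        [seq (if inord k \in H then s'`_k else 0) | k <- iota 0 8]
    + halt_prob (M := parity_qfa t) H (vec (take 4 s')) tp.
Proof.
move=> /= ->; rewrite [proj_span H _]proj_span_vec sqnorm_vec.
congr (_ + halt_prob _ _ _).
rewrite [LHS]proj_span_vec; apply: vec_eq => k k8.
rewrite nth_mkseq // nonhaltingE inordK //.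
case: ltnP => k4; first by rewrite nth_take.
by rewrite nth_default // size_take_min geq_min k4.
Qed.

Lemma halt_acc t s s' c tp :
  trans (parity_qfa t) c *m (s : state_vector R 'I_8) = vec s' ->
  halt_prob (acc (parity_qfa t)) s (c :: tp) =
    s'`_4 ^+ 2 + s'`_5 ^+ 2
    + halt_prob (acc (parity_qfa t)) (vec (take 4 s')) tp.
Proof.
move=> /halt_parity ->; congr (_ + _).
rewrite /dot !big_ord_recl big_ord0 /= !inE !inordK //=; ring.
Qed.

Lemma halt_rej t s s' c tp :
  trans (parity_qfa t) c *m (s : state_vector R 'I_8) = vec s' ->
  halt_prob (rej (parity_qfa t)) s (c :: tp) =
    s'`_6 ^+ 2 + s'`_7 ^+ 2
    + halt_prob (rej (parity_qfa t)) (vec (take 4 s')) tp.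
Proof.
move=> /halt_parity ->; congr (_ + _).
rewrite /dot !big_ord_recl big_ord0 /= !inE !inordK //=; ring.
Qed.

(** * Halting probabilities from the parities of the input *)

Lemma num_a_before_cons_a w :
  num_a_before_b (letter_a :: w) = (num_a_before_b w).+1.
Proof. by []. Qed.

Lemma num_a_after_cons_a w : num_a_after_b (letter_a :: w) = num_a_after_b w.
Proof. by []. Qed.

Lemma num_a_before_cons_b w : num_a_before_b (letter_b :: w) = 0.
Proof. by []. Qed.

Lemma num_a_after_cons_b w :
  num_a_after_b (letter_b :: w) = count_mem letter_a w.
Proof. by rewrite -[w in RHS]drop0. Qed.

Lemma num_a_total w :
  (num_a_before_b w + num_a_after_b w)%N = count_mem letter_a w.
Proof.
elim: w => [|[] w IH] //; last first.
  by rewrite num_a_before_cons_b num_a_after_cons_b.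
by rewrite num_a_before_cons_a num_a_after_cons_a addSn IH.
Qed.

(** Arbitrary amplitudes let the induction pass: an a swaps them in pairs, a b clears the first two.
    The first b accepts the share 9/25 of the right-parity weight. *)
Lemma accept_from t w x y z u :
  halt_prob (acc (parity_qfa t)) (vec [:: x; y; z; u])
      (rcons (map Letter w) RightEnd) =
    (if letter_b \in w then 9 / 25 else 1)
      * (if odd (num_a_before_b w) then y else x) ^+ 2
    + (if odd (num_a_before_b w + num_a_after_b w) then z else u) ^+ 2.
Proof.
elim: w x y z u => [|[] w IH] x y z u.
- by rewrite [LHS](halt_acc _ (trans_end t x y z u)) /=; ring.
- rewrite [LHS](halt_acc _ (trans_a t x y z u)) IH inE.
  rewrite num_a_before_cons_a num_a_after_cons_a addSn /=.
  by case: (_ \in w); case: (odd (num_a_before_b w)); case: odd => /=; field.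
- rewrite [LHS](halt_acc _ (trans_b t x y z u)) IH num_a_total inE eqxx.
  by rewrite num_a_before_cons_b num_a_after_cons_b add0n !if_same /=; field.
Qed.

(** The second term is the wrong-parity weight of the first counter, rejected in full at the first b
    or at the right end. *)
Lemma reject_from t w x y z u :
  halt_prob (rej (parity_qfa t)) (vec [:: x; y; z; u])
      (rcons (map Letter w) RightEnd) =
    (if letter_b \in w then 16 / 25 else 0)
      * (if odd (num_a_before_b w) then y else x) ^+ 2
    + (if odd (num_a_before_b w) then x else y) ^+ 2
    + (if odd (num_a_before_b w + num_a_after_b w) then u else z) ^+ 2.
Proof.
elim: w x y z u => [|[] w IH] x y z u.
- by rewrite [LHS](halt_rej _ (trans_end t x y z u)) /=; ring.
- rewrite [LHS](halt_rej _ (trans_a t x y z u)) IH inE.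
  rewrite num_a_before_cons_a num_a_after_cons_a addSn /=.
  by case: (_ \in w); case: (odd (num_a_before_b w)); case: odd => /=; field.
- rewrite [LHS](halt_rej _ (trans_b t x y z u)) IH num_a_total inE eqxx.
  by rewrite num_a_before_cons_b num_a_after_cons_b add0n !if_same /=; field.
Qed.

Lemma num_a_after_no_b w : letter_b \notin w -> num_a_after_b w = 0.
Proof.
by move=> wb; rewrite /num_a_after_b drop_oversize // (memNindex wb).
Qed.

(** The least favourable case is a word of [L] containing b, accepted with probability 9/25 * 16/25
    + 9/25 = 369/625 = 0.5904. *)
Lemma parity_recognizes t (L : pred (seq ab)) :
  (forall w, L w = (odd (num_a_before_b w) == t)
                   && ((letter_b \in w) ==> odd (num_a_after_b w))) ->
  recognizes_with (parity_qfa t) L (59 / 100).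
Proof.
move=> LE w; have -> : (w \in L) = L w by [].
pose s0 : seq R :=
  if t then [:: 0; 4 / 5; 0; 3 / 5] else [:: 4 / 5; 0; 3 / 5; 0].
have -> : accept_prob (parity_qfa t) w =
    halt_prob (acc (parity_qfa t)) (vec s0) (rcons (map Letter w) RightEnd).
  by rewrite [LHS](halt_acc _ (trans_start t)) /s0; case: (t) => /=; ring.
have -> : reject_prob (parity_qfa t) w =
    halt_prob (rej (parity_qfa t)) (vec s0) (rcons (map Letter w) RightEnd).
  by rewrite [LHS](halt_rej _ (trans_start t)) /s0; case: (t) => /=; ring.
rewrite LE /s0 {s0}.
have [bw|nbw] := boolP (letter_b \in w); last rewrite (num_a_after_no_b nbw).
  case: t {LE}; rewrite accept_from reject_from bw oddD;
    by case: (odd (num_a_before_b w)); case: odd; split => //= _; lra.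
case: t {LE};
  rewrite accept_from reject_from (negbTE nbw) num_a_after_no_b // addn0;
  by case: (odd (num_a_before_b w)); split => //= _; lra.
Qed.

End ParityAutomaton.

Lemma L2_recognizable (R : realType) : recognizable R L2.
Proof.
exists (parity_qfa R false), (59 / 100); split; first by lra.
by apply: parity_recognizes => w; rewrite eqbF_neg.
Qed.

Lemma L3_recognizable (R : realType) : recognizable R L3.
Proof.
exists (parity_qfa R true), (59 / 100); split; first by lra.
by apply: parity_recognizes => w; rewrite eqb_id.
Qed.

Theorem theorem3p1 (R : realType) :
  recognizable R L2 /\ recognizable R L3 /\ ~ recognizable R L1.
Proof.
split; first exact: L2_recognizable.
split; [exact: L3_recognizable|exact: L1_not_recognizable].
Qed.
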